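(* Let $p$ be a prime and let $(A,+,\cdot)$ be a pre-Lie algebra over $\mathbb{F}_p$ with $(A,+)\cong C_p^5$, generated by two elements $x$ and $y$ (and by no fewer elements) as a pre-Lie algebra. Assume $A^{[4]}\neq 0$ and $A^{[5]}=0$. Put $S=\{x\cdot x,\ x\cdot y,\ y\cdot x,\ y\cdot y\}$. Then the following hold. (1) $A$ has an $\mathbb{F}_p$-basis $\{x,y,u,v,w\}$ where $u\in S\setminus A^{[3]}$, $v$ is of the form $c\cdot d$ with $c\in\{x,y\}$ and $d=u$, or vice versa, and $w$ is any non-zero element of $A^{[4]}$. (2) $A^{[2]}/A^{[3]}=\mathbb{F}_pu$, $A^{[3]}/A^{[4]}=\mathbb{F}_pv$ and $A^{[4]}=\mathbb{F}_pw$. (3) For $i,j\in\{x,y\}$ write $i\cdot j=\alpha_{ij}u+\beta_{ij}v+\gamma_{ij}w$; not all $\alpha_{ij}$ are $0$. For $k\in\{x,y\}$ and $l=u$, or vice versa, write $k\cdot l=\delta_{kl}v+\nu_{kl}w$; not all $\delta_{kl}$ are $0$. Write $u\cdot u=\mu_{uu}w$, and for $m=v$, $n\in\{x,y\}$, or vice versa, write $m\cdot n=\mu_{mn}w$ (all coefficients in $\mathbb{F}_p$). Then $$\alpha_{xy}\delta_{ux}-\alpha_{yx}\delta_{xu}=\alpha_{yx}\delta_{ux}-\alpha_{xx}\delta_{yu},$$ $$\alpha_{yx}\delta_{uy}-\alpha_{xy}\delta_{yu}=\alpha_{xy}\delta_{uy}-\alpha_{yy}\delta_{xu},$$ $$\alpha_{xy}\nu_{ux}+\beta_{xy}\mu_{vx}-\alpha_{yx}\nu_{xu}-\beta_{yx}\mu_{xv}=\alpha_{yx}\nu_{ux}+\beta_{yx}\mu_{vx}-\alpha_{xx}\nu_{yu}-\beta_{xx}\mu_{yv},$$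 $$\alpha_{yx}\nu_{uy}+\beta_{yx}\mu_{vy}-\alpha_{xy}\nu_{yu}-\beta_{xy}\mu_{yv}=\alpha_{xy}\nu_{uy}+\beta_{xy}\mu_{vy}-\alpha_{yy}\nu_{xu}-\beta_{yy}\mu_{xv},$$ $$\alpha_{xy}^2\mu_{uu}-\alpha_{xy}\delta_{yu}\mu_{xv}=\alpha_{yx}\alpha_{xy}\mu_{uu}-\alpha_{xy}\delta_{xu}\mu_{yv},$$ $$\alpha_{xy}\alpha_{yx}\mu_{uu}-\alpha_{yx}\delta_{yu}\mu_{xv}=\alpha_{yx}^2\mu_{uu}-\alpha_{yx}\delta_{xu}\mu_{yv},$$ $$\alpha_{xy}\alpha_{xx}\mu_{uu}-\alpha_{xx}\delta_{yu}\mu_{xv}=\alpha_{yx}\alpha_{xx}\mu_{uu}-\alpha_{xx}\delta_{xu}\mu_{yv},$$ $$\alpha_{xy}\alpha_{yy}\mu_{uu}-\alpha_{yy}\delta_{yu}\mu_{xv}=\alpha_{yx}\alpha_{yy}\mu_{uu}-\alpha_{yy}\delta_{xu}\mu_{yv},$$ $$\delta_{xu}\mu_{vy}-\delta_{uy}\mu_{xv}=\delta_{ux}\mu_{vy}-\alpha_{xy}\mu_{uu},$$ $$\delta_{xu}\mu_{vx}-\delta_{ux}\mu_{xv}=\delta_{ux}\mu_{vx}-\alpha_{xx}\mu_{uu},$$ $$\delta_{yu}\mu_{vy}-\delta_{uy}\mu_{yv}=\delta_{uy}\mu_{vy}-\alpha_{yy}\mu_{uu},$$ $$\delta_{yu}\mu_{vx}-\delta_{ux}\mu_{yv}=\delta_{uy}\mu_{vx}-\alpha_{yx}\mu_{uu}.$$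 (4) Conversely, if $A$ is a five-dimensional $\mathbb{F}_p$-vector space with a bilinear product (not assumed to be pre-Lie) generated by $x,y$, with $A^{[4]}\ne0$, $A^{[5]}=0$, and satisfying (1)–(3), then $A$ is a well defined pre-Lie algebra.
   Context: A pre-Lie algebra over $\mathbb{F}_p$ is an $\mathbb{F}_p$-vector space $A$ with a bilinear product $\cdot$ satisfying $(a\cdot b)\cdot c-a\cdot(b\cdot c)=(b\cdot a)\cdot c-b\cdot(a\cdot c)$ for all $a,b,c\in A$. For subspaces $B,C\subseteq A$, $B\cdot C$ denotes the subspace spanned by all $b\cdot c$ with $b\in B$, $c\in C$. Define (for any bilinear product) $A^{[1]}=A$ and $A^{[i+1]}=\sum_{j=1}^{i}A^{[j]}\cdot A^{[i+1-j]}$ for $i\ge 1$. $A^{[i]}/A^{[j]}=\mathbb{F}_pa$ means the quotient is spanned by the image of $a\in A^{[i]}$. *)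

(* Defs.v *)
From HB Require Import structures.
From mathcomp Require Export all_boot all_order all_algebra.

Set Implicit Arguments.
Unset Strict Implicit.
Unset Printing Implicit Defensive.

Import GRing.Theory.
Local Open Scope ring_scope.

Section BilinearProduct.

Variables (F : fieldType) (A : vectType F) (mul : {bilinear A -> A -> A}).
Implicit Types (B C U V : {vspace A}) (a b c x y u v w : A).

Definition pre_Lie := forall a b c,
  mul (mul a b) c - mul a (mul b c) = mul (mul b a) c - mul b (mul a c).

(* The span of the products of basis vectors, as for prodv in falgebra.v;
   by bilinearity it is the span of all the products (prodspP below). *)
Definition prodsp B C : {vspace A} :=
  <<[seq mul b c | b <- vbasis B, c <- vbasis C]>>%VS.

Lemma memv_prodsp B C b c : b \in B -> c \in C -> mul b c \in prodsp B C.
Proof.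
move=> /coord_vbasis-> /coord_vbasis->.
rewrite linear_sumlz; apply: memv_suml => i _.
rewrite linearZl_LR linear_sumr memvZ //; apply: memv_suml => j _.
rewrite linearZr_LR memvZ //; apply/memv_span/allpairsP.
by exists ((vbasis B)`_i, (vbasis C)`_j); rewrite !mem_nth ?size_tuple.
Qed.

Lemma prodspP B C V :
  reflect (forall b c, b \in B -> c \in C -> mul b c \in V)
          (prodsp B C <= V)%VS.
Proof.
apply: (iffP idP) => [sV b c Bb Cc | sV].
  exact: (subvP sV) (memv_prodsp Bb Cc).
by apply/span_subvP => _ /allpairsP[[b c] /= [/vbasis_mem Bb /vbasis_mem Cc ->]];
  apply: sV.
Qed.

(* lpow i is A^[i] for i >= 1, with the junk value A at i = 0.  The recursion is
   not structural, so lpow_rec takes a bound n >= i on its depth; lpow1 and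
   lpowS are the defining equations. *)
Fixpoint lpow_rec (n i : nat) : {vspace A} :=
  if n isn't n'.+1 then fullv else
  if (i <= 1)%N then fullv else
  (\sum_(1 <= j < i) prodsp (lpow_rec n' j) (lpow_rec n' (i - j)%N))%VS.

Definition lpow (i : nat) : {vspace A} := lpow_rec i i.

Lemma lpow1 : lpow 1 = fullv. Proof. by []. Qed.

Lemma lpow_recE n i : (i <= n)%N -> lpow_rec n i = lpow i.
Proof.
rewrite /lpow; have [m] := ubnP i.
elim: m i n => // m IHm [|i] [|n] //= ltim lein; case: ifP => // _.
rewrite !big_seq; apply: eq_bigr => j; rewrite mem_index_iota => /andP[j0 ji].
have lti : (i.+1 - j <= i)%N by rewrite leq_subLR -addn1 addnC leq_add2r.
have leji : (j <= i)%N by [].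
have im : (i < m)%N by [].
by rewrite !IHm // ?(leq_trans leji) ?(leq_trans lti) ?(leq_ltn_trans leji)
  ?(leq_ltn_trans lti).
Qed.

Lemma lpowS i : (1 <= i)%N ->
  lpow i.+1 = (\sum_(1 <= j < i.+1) prodsp (lpow j) (lpow (i.+1 - j)%N))%VS.
Proof.
case: i => // i _.
have -> : lpow i.+2 = (\sum_(1 <= j < i.+2)
    prodsp (lpow_rec i.+1 j) (lpow_rec i.+1 (i.+2 - j)%N))%VS by [].
rewrite !big_seq; apply: eq_bigr => j.
rewrite mem_index_iota => /andP[j0 ji].
by rewrite !(lpow_recE (n := i.+1)) // leq_subLR -addn1 addnC leq_add2r.
Qed.

Definition subalgebra B := forall a b, a \in B -> b \in B -> mul a b \in B.

Definition generates (s : seq A) :=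
  forall B, subalgebra B -> {subset s <= B} -> B = fullv.

Definition minimally_generates (s : seq A) :=
  generates s /\ forall t, generates t -> (size s <= size t)%N.

(* U / V is spanned by the image of a. *)
Definition quotient_line U V a :=
  [/\ (V <= U)%VS, a \in U
    & forall b, b \in U -> exists k : F, b - k *: a \in V].

Definition adapted x y u v w :=
  [/\ basis_of fullv [:: x; y; u; v; w],
      u \in [:: mul x x; mul x y; mul y x; mul y y],
      u \notin lpow 3,
      exists2 c, c \in [:: x; y] & v = mul c u \/ v = mul u c
    & w \in lpow 4 /\ w != 0].

Definition quotients_spanned u v w :=
  [/\ quotient_line (lpow 2) (lpow 3) u,
      quotient_line (lpow 3) (lpow 4) v
    & lpow 4 = <[w]>%VS].

(* The coefficient families are indexed by the elements of A themselves, only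
   their values at the pairs occurring below being relevant. *)
Definition expansions x y u v w (alpha beta gamma delta nu mu : A -> A -> F) :=
  [/\ forall i j, i \in [:: x; y] -> j \in [:: x; y] ->
        mul i j = alpha i j *: u + beta i j *: v + gamma i j *: w,
      forall k, k \in [:: x; y] ->
        mul k u = delta k u *: v + nu k u *: w /\
        mul u k = delta u k *: v + nu u k *: w,
      mul u u = mu u u *: w
    & forall n, n \in [:: x; y] ->
        mul v n = mu v n *: w /\ mul n v = mu n v *: w].

Definition relations x y u v (alpha beta delta nu mu : A -> A -> F) : Prop :=
     alpha x y * delta u x - alpha y x * delta x u
       = alpha y x * delta u x - alpha x x * delta y u
  /\ alpha y x * delta u y - alpha x y * delta y u
       = alpha x y * delta u y - alpha y y * delta x u
  /\ alpha x y * nu u x + beta x y * mu v x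
       - alpha y x * nu x u - beta y x * mu x v
       = alpha y x * nu u x + beta y x * mu v x
       - alpha x x * nu y u - beta x x * mu y v
  /\ alpha y x * nu u y + beta y x * mu v y
       - alpha x y * nu y u - beta x y * mu y v
       = alpha x y * nu u y + beta x y * mu v y
       - alpha y y * nu x u - beta y y * mu x v
  /\ alpha x y ^+ 2 * mu u u - alpha x y * delta y u * mu x v
       = alpha y x * alpha x y * mu u u - alpha x y * delta x u * mu y v
  /\ alpha x y * alpha y x * mu u u - alpha y x * delta y u * mu x v
       = alpha y x ^+ 2 * mu u u - alpha y x * delta x u * mu y v
  /\ alpha x y * alpha x x * mu u u - alpha x x * delta y u * mu x v
       = alpha y x * alpha x x * mu u u - alpha x x * delta x u * mu y v
  /\ alpha x y * alpha y y * mu u u - alpha y y * delta y u * mu x v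
       = alpha y x * alpha y y * mu u u - alpha y y * delta x u * mu y v
  /\ delta x u * mu v y - delta u y * mu x v
       = delta u x * mu v y - alpha x y * mu u u
  /\ delta x u * mu v x - delta u x * mu x v
       = delta u x * mu v x - alpha x x * mu u u
  /\ delta y u * mu v y - delta u y * mu y v
       = delta u y * mu v y - alpha y y * mu u u
  /\ delta y u * mu v x - delta u x * mu y v
       = delta u y * mu v x - alpha y x * mu u u.

(* The coefficients are unique when x, y, u, v, w is a basis, and then choosing
   them existentially or universally makes no difference. *)
Definition structure_relations x y u v w :=
  exists alpha beta gamma delta nu mu : A -> A -> F,
    [/\ expansions x y u v w alpha beta gamma delta nu mu,
        ~ (forall i j, i \in [:: x; y] -> j \in [:: x; y] -> alpha i j = 0),
        ~ (forall k, k \in [:: x; y] -> delta k u = 0 /\ delta u k = 0)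
      & relations x y u v alpha beta delta nu mu].

End BilinearProduct.

(* Main.v *)
Require Import Defs.
From mathcomp Require Import ring zify.

Set Implicit Arguments.
Unset Strict Implicit.
Unset Printing Implicit Defensive.

Import GRing.Theory.
Local Open Scope ring_scope.

(** Write A_i for the i-th power of A.  The product maps A_i x A_j into A_(i+j),
    and when A is nilpotent a family generates A if and only if it spans A
    modulo A_2 ([generates_modulo], [generates_of_modulo]).  So two generators
    being necessary means that A_2 has codimension 2, that is, dimension 3
    ([dim_lpow2]).

    The pre-Lie identity, solved for a(bc) with a in A_2, puts A_2 A_2 inside
    A A_3 + A_3 A; hence A_4 = A A_3 + A_3 A, just as A_3 = A A_2 + A_2 A
    ([pre_Lie_lpow4]).  An equality A_2 = A_3 would therefore propagate to
    A_3 = A_4, and that one to A_4 = A_5 = 0.  The inclusions being strict, the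
    powers have dimensions 5, 3, 2, 1, 0 ([dim_lpow34]).  Each quotient of
    successive powers is spanned by products of a generator with what spans the
    previous one, which yields u and v; as the last three non-zero quotients have
    dimension 1, they are spanned by u, v and any non-zero w in A_4, so that
    x, y, u, v, w is a basis.

    Both directions of the structure relations come from a single computation.
    The defect of the pre-Lie identity at (a, b, c) is trilinear, antisymmetric
    in a and b, and has degree at least 5, hence vanishes, unless the degrees of
    a, b, c in the filtered basis x, y, u, v, w sum to at most 4.  Only the
    triples made of generators and at most one u remain, and there the defect is
    a combination of v and w whose coefficients are, up to sign, the differences
    of the two sides of the relations ([defect_gen], [defect_gen_u],
    [defect_u_gen]).  The four relations whose terms share a factor alpha i j are
    the one coming from (x, y, u) multiplied by alpha i j; since some alpha is
    non-zero, they are together equivalent to it. *)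

(** * Lines in quotients of vector spaces *)

Section Lines.

Variables (F : fieldType) (A : vectType F).
Implicit Types (U V : {vspace A}) (a b : A) (X : seq A).

Lemma dim_lt_addv1 V a : a \notin V -> (\dim V < \dim (<[a]> + V)%VS)%N.
Proof.
move=> aV; have [sV eqV] := dimv_leqif_sup (addvSr <[a]>%VS V).
rewrite ltn_neqAle sV eqV andbT; apply: contra aV => /subvP; apply.
exact: subvP (addvSl _ _) _ (memv_line a).
Qed.

Lemma addv1_eq U V a :
  (V <= U)%VS -> a \in U -> a \notin V -> (\dim U <= (\dim V).+1)%N ->
  U = (<[a]> + V)%VS.
Proof.
move=> sVU Ua aV dU; apply/eqP; rewrite eq_sym eqEdim.
rewrite (leq_trans dU (dim_lt_addv1 aV)) andbT.
by rewrite subv_add -memvE Ua.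
Qed.

Lemma quotient_line_dim U V a :
  (V <= U)%VS -> a \in U -> a \notin V -> (\dim U <= (\dim V).+1)%N ->
  quotient_line U V a.
Proof.
move=> sVU Ua aV dU; split=> // b.
rewrite (addv1_eq sVU Ua aV dU) => /memv_addP[_ /vlineP[k ->] [c Vc ->]].
by exists k; rewrite addrC addKr.
Qed.

Lemma dim_lt_subv U V : (U <= V)%VS -> ~~ (V <= U)%VS -> (\dim U < \dim V)%N.
Proof.
by move=> sUV nsVU; have [le eq] := dimv_leqif_sup sUV; rewrite ltn_neqAle le eq nsVU.
Qed.

Lemma linear_span0 (f : A -> A) X a :
  (forall k b c, f (k *: b + c) = k *: f b + f c) ->
  (forall b, b \in X -> f b = 0) -> a \in <<X>>%VS -> f a = 0.
Proof.
move=> lin_f; have f0 : f 0 = 0.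
  by move: (lin_f (-1) 0 0); rewrite scaler0 addr0 scaleN1r addNr.
elim: X a => [|d X IHX] a X0; first by rewrite span_nil memv0 => /eqP->.
rewrite span_cons => /memv_addP[_ /vlineP[k ->] [c Xc ->]].
rewrite lin_f X0 ?mem_head // scaler0 add0r IHX // => b Xb.
by apply: X0; rewrite inE Xb orbT.
Qed.

End Lines.

(** * The power filtration *)

Section Filtration.

Variables (F : fieldType) (A : vectType F) (mul : {bilinear A -> A -> A}).
Implicit Types (B U V W : {vspace A}) (a b c : A) (X Y : seq A).
Local Notation lpow := (lpow mul).
Local Notation prodsp := (prodsp mul).

Lemma prodspS U U' V V' :
  (U <= U')%VS -> (V <= V')%VS -> (prodsp U V <= prodsp U' V')%VS.
Proof.
move=> sU sV; apply/prodspP => b c Ub Vc.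
by rewrite memv_prodsp ?(subvP sU) ?(subvP sV).
Qed.

Lemma prodsp_span_subv X Y W :
  (forall b c, b \in X -> c \in Y -> mul b c \in W) ->
  (prodsp <<X>> <<Y>> <= W)%VS.
Proof.
move=> sW; apply/prodspP => b c.
rewrite -[X]in_tupleE -[Y]in_tupleE => /coord_span-> /coord_span->.
rewrite linear_sumlz; apply: memv_suml => i _.
rewrite linearZl_LR linear_sumr memvZ //; apply: memv_suml => j _.
by rewrite linearZr_LR memvZ //; apply: sW; rewrite mem_nth ?size_tuple.
Qed.

Lemma prodspDl U U' V : prodsp (U + U') V = (prodsp U V + prodsp U' V)%VS.
Proof.
apply/eqP; rewrite eqEsubv; apply/andP; split.
  apply/prodspP => _ c /memv_addP[a Ua [b Ub ->]] Vc.
  by rewrite linearDl memv_add ?memv_prodsp.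
by rewrite subv_add !prodspS ?addvSl ?addvSr.
Qed.

Lemma prodspDr U V V' : prodsp U (V + V') = (prodsp U V + prodsp U V')%VS.
Proof.
apply/eqP; rewrite eqEsubv; apply/andP; split.
  apply/prodspP => c _ Uc /memv_addP[a Va [b Vb ->]].
  by rewrite linearDr memv_add ?memv_prodsp.
by rewrite subv_add !prodspS ?addvSl ?addvSr.
Qed.

Lemma prodsp_lpow i j :
  (0 < i)%N -> (0 < j)%N -> (prodsp (lpow i) (lpow j) <= lpow (i + j))%VS.
Proof.
case: i => // i _; case: j => // j _; rewrite addSn addnS (@lpowS _ _ _ (i + j).+1) //.
rewrite (bigD1_seq i.+1) ?iota_uniq ?mem_index_iota //=.
  have -> : ((i + j).+2 - i.+1)%N = j.+1 by lia.
  exact: addvSl.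
by lia.
Qed.

Lemma mul_lpow i j a b :
  (0 < i)%N -> (0 < j)%N -> a \in lpow i -> b \in lpow j ->
  mul a b \in lpow (i + j).
Proof.
by move=> i0 j0 ai bj; apply: subvP (prodsp_lpow i0 j0) _ (memv_prodsp _ ai bj).
Qed.

Lemma prodsp_fullv_lpow i :
  (0 < i)%N -> (prodsp fullv (lpow i) <= lpow i.+1)%VS.
Proof. by move=> i0; rewrite -(lpow1 mul) -[i.+1]add1n prodsp_lpow. Qed.

Lemma prodsp_lpow_fullv i :
  (0 < i)%N -> (prodsp (lpow i) fullv <= lpow i.+1)%VS.
Proof. by move=> i0; rewrite -(lpow1 mul) -(addn1 i) prodsp_lpow. Qed.

(** In a product A_j A_(i+1-j), the index to lower is j when j > 1, and the other
    one when j = 1. *)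
Lemma lpow_subS i : (0 < i)%N -> (lpow i.+1 <= lpow i)%VS.
Proof.
elim/ltn_ind: i => -[|[|i]] // IHi _; first exact: subvf.
rewrite lpowS // big_seq; apply: (big_ind (fun U => U <= lpow i.+2)%VS) => //.
- exact: sub0v.
- by move=> U V sU sV; rewrite subv_add sU.
move=> [|[|j]]; rewrite mem_index_iota //= => ltji.
  rewrite subn1 /=; apply: subv_trans (prodsp_fullv_lpow (ltn0Sn i)).
  by rewrite prodspS // IHi.
have -> : lpow i.+2 = lpow (j.+1 + (i.+3 - j.+2)) by congr lpow; lia.
apply: subv_trans (prodsp_lpow _ _); rewrite ?subn_gt0 //.
by rewrite prodspS // IHi.
Qed.

Lemma lpowS_sub i j : (0 < i <= j)%N -> (lpow j <= lpow i)%VS.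
Proof.
case/andP=> i0 /subnK <-; elim: (j - i)%N => // k IHk.
by apply: subv_trans IHk; rewrite lpow_subS // addn_gt0 i0 orbT.
Qed.

Lemma lpow2 : lpow 2 = prodsp fullv fullv.
Proof. by rewrite lpowS // big_nat1 !lpow1. Qed.

Lemma lpow3 : lpow 3 = (prodsp fullv (lpow 2) + prodsp (lpow 2) fullv)%VS.
Proof. by rewrite lpowS // big_ltn // big_nat1 !lpow1. Qed.

Lemma lpow4 : lpow 4 =
  (prodsp fullv (lpow 3) + (prodsp (lpow 2) (lpow 2) + prodsp (lpow 3) fullv))%VS.
Proof. by rewrite lpowS // big_ltn // big_ltn // big_nat1 !lpow1. Qed.

(** The sum <<s>> + A_2 is a subalgebra because it contains every product. *)
Lemma generates_modulo s :
  generates mul s -> (<<s>> + lpow 2)%VS = fullv.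
Proof.
apply=> [a b _ _|a sa].
  by apply: subvP (addvSr _ _) _ _; rewrite lpow2 memv_prodsp ?memvf.
exact: subvP (addvSl _ _) _ (memv_span sa).
Qed.

(** The nilpotent form of the Nakayama lemma: if a subalgebra B satisfies
    A = B + A_2, then multiplying A = B + A_k by itself gives A_2 inside
    B + A_(k+1), hence A = B + A_(k+1), until the power vanishes. *)
Lemma generates_of_modulo s n : (0 < n)%N -> lpow n = 0%VS ->
  (<<s>> + lpow 2)%VS = fullv -> generates mul s.
Proof.
move=> n0 nil As B algB sB.
have {}sB : (<<s>> <= B)%VS by apply/span_subvP.
have AB k : (B + lpow k.+1)%VS = fullv.
  elim: k => [|k IHk]; first by rewrite lpow1 addvf.
  have sA2 : (lpow 2 <= B + lpow k.+2)%VS.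
    rewrite lpow2 -{1}IHk prodspDl subv_add; apply/andP; split.
      rewrite -IHk prodspDr subv_add; apply/andP; split.
        by apply/prodspP => b c Bb Bc; apply: subvP (addvSl _ _) _ (algB _ _ Bb Bc).
      apply: subv_trans (addvSr _ _).
      apply: subv_trans (prodsp_fullv_lpow (ltn0Sn k)).
      by rewrite prodspS // subvf.
    by apply: subv_trans (addvSr _ _); apply: prodsp_lpow_fullv.
  apply/eqP; rewrite eqEsubv subvf -As subv_add sA2 andbT.
  exact: subv_trans sB (addvSl _ _).
by rewrite -(AB n.-1) prednK // nil addv0.
Qed.

(** Modulo W, only the products of the representatives X and Y matter, as soon
    as W absorbs the products involving the subspaces U and U'. *)
Lemma prodsp_sub_modulo X Y U U' W :
  (forall b c, b \in X -> c \in Y -> mul b c \in W) ->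
  (prodsp U (<<Y>> + U') <= W)%VS -> (prodsp (<<X>> + U) U' <= W)%VS ->
  (prodsp (<<X>> + U) (<<Y>> + U') <= W)%VS.
Proof.
move=> sXY sU sU'; rewrite prodspDl subv_add sU andbT prodspDr subv_add.
rewrite prodsp_span_subv //=; apply: subv_trans sU'.
by rewrite prodspS // addvSl.
Qed.

End Filtration.

(** * Five-dimensional pre-Lie algebras of maximal class *)

Section FiveDimensional.

Variables (F : fieldType) (A : vectType F) (mul : {bilinear A -> A -> A}).
Variables x y : A.
Implicit Types (a b c u v w : A).
Local Notation lpow := (lpow mul).
Local Notation prodsp := (prodsp mul).

(** The term A_2 A_2 is redundant in A_4: for a in A_2,
    a(bc) = (ab)c - (ba)c + b(ac), where ab, ba and ac lie in A_3. *)
Lemma pre_Lie_lpow4 : pre_Lie mul ->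
  lpow 4 = (prodsp fullv (lpow 3) + prodsp (lpow 3) fullv)%VS.
Proof.
move=> preLie; set W := (_ + _)%VS.
have WL a b : b \in lpow 3 -> mul a b \in W.
  by move=> b3; apply: subvP (addvSl _ _) _ (memv_prodsp _ (memvf a) b3).
have WR a b : a \in lpow 3 -> mul a b \in W.
  by move=> a3; apply: subvP (addvSr _ _) _ (memv_prodsp _ a3 (memvf b)).
apply/eqP; rewrite lpow4 addvA [(prodsp fullv _ + _)%VS]addvC -addvA.
rewrite eqEsubv addvSr subv_add subvv !andbT.
apply/prodspP => a b a2 b2.
suff sub : (lpow 2 <= linfun (mul a) @^-1: W)%VS.
  by move: (subvP sub b b2); rewrite -memv_preim lfunE.
rewrite lpow2; apply/prodspP => {b2}b c _ _; rewrite -memv_preim lfunE /=.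
have -> : mul a (mul b c) = mul (mul a b) c - mul (mul b a) c + mul b (mul a c).
  by rewrite -addrA (addrC (- _)) -opprB -preLie subKr.
have ab3 d : mul a d \in lpow 3.
  by apply: (mul_lpow (i := 2) (j := 1)) => //; rewrite lpow1 memvf.
have ba3 d : mul d a \in lpow 3.
  by apply: (mul_lpow (i := 1) (j := 2)) => //; rewrite lpow1 memvf.
by apply: memvD; [apply: memvB; apply: WR | apply: WL].
Qed.

Hypotheses (dimA : \dim {:A} = 5%N) (preLie : pre_Lie mul).
Hypothesis min_gen : minimally_generates mul [:: x; y].
Hypotheses (lpow4_neq0 : lpow 4 <> 0%VS) (lpow5_eq0 : lpow 5 = 0%VS).

(** By minimality neither x nor y alone spans A modulo A_2, so adding y and then x
    to A_2 raises the dimension each time, up to 5. *)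
Lemma dim_lpow2 : \dim (lpow 2) = 3%N.
Proof.
have [gen min] := min_gen.
have not1 z : ~ (<[z]> + lpow 2)%VS = fullv.
  rewrite -span_seq1 => /(generates_of_modulo _ lpow5_eq0) gen1.
  by have /= := min _ (gen1 isT).
have A2 : (<[x]> + (<[y]> + lpow 2))%VS = fullv.
  by rewrite -(generates_modulo gen) span_cons span_seq1 addvA.
have y2 : y \notin lpow 2.
  apply/negP => y2; apply: (not1 x); rewrite -[RHS]A2; congr (_ + _)%VS.
  by apply/esym/addv_idPr; rewrite -memvE.
have x2 : x \notin (<[y]> + lpow 2)%VS.
  by apply/negP => x2; apply: (not1 y); rewrite -A2; apply/esym/addv_idPr; rewrite -memvE.
have lt1 := dim_lt_addv1 y2; have lt2 := dim_lt_addv1 x2.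
rewrite A2 dimA in lt2.
have [le1 _] := dimv_add_leqif <[x]>%VS (<[y]> + lpow 2)%VS.
have [le2 _] := dimv_add_leqif <[y]>%VS (lpow 2).
have le3 := leq_b1 (x != 0); have le4 := leq_b1 (y != 0).
rewrite -!dim_vline in le3 le4; rewrite A2 dimA in le1; lia.
Qed.

(** If A_3 = A_4 then A_4 = A A_3 + A_3 A = A A_4 + A_4 A is inside A_5 = 0. *)
Lemma lpow3_nsub : ~~ (lpow 3 <= lpow 4)%VS.
Proof.
apply/negP => s34; apply: lpow4_neq0; apply/eqP; rewrite -subv0 -lpow5_eq0.
rewrite (pre_Lie_lpow4 preLie) subv_add; apply/andP; split.
  by apply: subv_trans (prodsp_fullv_lpow mul (i := 4) isT); rewrite prodspS.
by apply: subv_trans (prodsp_lpow_fullv mul (i := 4) isT); rewrite prodspS.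
Qed.

Lemma lpow2_nsub : ~~ (lpow 2 <= lpow 3)%VS.
Proof.
apply: contra lpow3_nsub => s23; rewrite lpow3 (pre_Lie_lpow4 preLie).
rewrite subv_add; apply/andP; split.
  by apply: subv_trans (addvSl _ _); apply: prodspS s23; apply: subvv.
by apply: subv_trans (addvSr _ _); apply: prodspS s23 _; apply: subvv.
Qed.

Lemma dim_lpow34 : \dim (lpow 3) = 2%N /\ \dim (lpow 4) = 1%N.
Proof.
have lt32 := dim_lt_subv (lpow_subS mul (i := 2) isT) lpow2_nsub.
have lt43 := dim_lt_subv (lpow_subS mul (i := 3) isT) lpow3_nsub.
have: \dim (lpow 4) != 0%N by rewrite dimv_eq0; apply/eqP.
by rewrite dim_lpow2 in lt32; lia.
Qed.

Lemma fullv_modulo : fullv = (<<[:: x; y]>> + lpow 2)%VS.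
Proof. by have [/generates_modulo] := min_gen. Qed.

(** Otherwise A_2 = A A, which is spanned modulo A_3 by the products of generators,
    would be inside A_3. *)
Lemma exists_generator_product :
  exists2 u, u \in [:: mul x x; mul x y; mul y x; mul y y] & u \notin lpow 3.
Proof.
case: (altP (allP (a := mem (lpow 3))
    (s := [:: mul x x; mul x y; mul y x; mul y y]))) => [S3 | /allPn //].
case/negP: lpow2_nsub; rewrite lpow2 [X in prodsp X]fullv_modulo.
rewrite [X in (prodsp _ X)]fullv_modulo.
apply: prodsp_sub_modulo.
- by move=> b c; rewrite !inE => /orP[]/eqP-> /orP[]/eqP->; apply: S3;
    rewrite !inE eqxx ?orbT.
- rewrite -fullv_modulo; exact: prodsp_lpow_fullv.
- rewrite -fullv_modulo; exact: prodsp_fullv_lpow.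
Qed.

Lemma generator_product_lpow2 u :
  u \in [:: mul x x; mul x y; mul y x; mul y y] -> u \in lpow 2.
Proof.
by rewrite !inE => /or4P[]/eqP->; rewrite lpow2 memv_prodsp ?memvf.
Qed.

Lemma mul_lpow2_lpow3 a b : a \in lpow 2 ->
  (mul a b \in lpow 3) * (mul b a \in lpow 3).
Proof.
by move=> a2; split; [apply: (mul_lpow (i := 2) (j := 1))
  | apply: (mul_lpow (i := 1) (j := 2))]; rewrite ?lpow1 ?memvf.
Qed.

Lemma lpow2_modulo u : u \in lpow 2 -> u \notin lpow 3 ->
  lpow 2 = (<<[:: u]>> + lpow 3)%VS.
Proof.
move=> u2 u3; rewrite span_seq1.
apply: addv1_eq u2 u3 _; first exact: lpow_subS.
by rewrite dim_lpow2; have [-> _] := dim_lpow34.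
Qed.

Lemma lpow3_modulo v : v \in lpow 3 -> v \notin lpow 4 ->
  lpow 3 = (<<[:: v]>> + lpow 4)%VS.
Proof.
move=> v3 v4; rewrite span_seq1.
apply: addv1_eq v3 v4 _; first exact: lpow_subS.
by have [-> ->] := dim_lpow34.
Qed.

Lemma lpow4_line w : w \in lpow 4 -> w != 0 -> lpow 4 = <[w]>%VS.
Proof.
move=> w4 w0; rewrite -[RHS]addv0; apply: addv1_eq (sub0v _) w4 _ _.
  by rewrite memv0.
by have [_ ->] := dim_lpow34.
Qed.

(** Otherwise A_3 = A A_2 + A_2 A would be inside A_4, because A_2 is spanned by u
    modulo A_3. *)
Lemma exists_generator_triple u : u \in lpow 2 -> u \notin lpow 3 ->
  exists2 c, c \in [:: x; y] & (mul c u \notin lpow 4) || (mul u c \notin lpow 4).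
Proof.
move=> u2 u3; apply/hasP/negPn; rewrite -all_predC; apply/negP => /allP /= uS.
case/negP: lpow3_nsub; rewrite lpow3 (lpow2_modulo u2 u3) fullv_modulo.
have {}uS c : c \in [:: x; y] -> (mul c u \in lpow 4) * (mul u c \in lpow 4).
  by move/uS; rewrite negb_or !negbK => /andP[].
rewrite subv_add; apply/andP; split; apply: prodsp_sub_modulo.
- by move=> b c /uS bu; rewrite inE => /eqP->; rewrite bu.
- by rewrite -(lpow2_modulo u2 u3); apply: (prodsp_lpow mul (i := 2) (j := 2)).
- by rewrite -fullv_modulo; apply: prodsp_fullv_lpow.
- by move=> c b; rewrite inE => /eqP-> /uS bu; rewrite bu.
- by rewrite -fullv_modulo; apply: prodsp_lpow_fullv.
- by rewrite -(lpow2_modulo u2 u3); apply: (prodsp_lpow mul (i := 2) (j := 2)).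
Qed.

Lemma filtered_basis u v w :
  u \in lpow 2 -> u \notin lpow 3 -> v \in lpow 3 -> v \notin lpow 4 ->
  w \in lpow 4 -> w != 0 -> basis_of fullv [:: x; y; u; v; w].
Proof.
move=> u2 u3 v3 v4 w4 w0; rewrite basisEdim dimA andbT.
rewrite [X in (X <= _)%VS]fullv_modulo (lpow2_modulo u2 u3) (lpow3_modulo v3 v4).
by rewrite (lpow4_line w4 w0) -span_seq1 -!span_cat.
Qed.

Lemma exists_adapted : exists u v : A, forall w : A,
  w \in lpow 4 -> w != 0 -> adapted mul x y u v w.
Proof.
have [u uS u3] := exists_generator_product.
have u2 := generator_product_lpow2 uS.
have [c cxy cu] := exists_generator_triple u2 u3.
suff [v vcu v4] : exists2 v, v = mul c u \/ v = mul u c & v \notin lpow 4.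
  have v3 : v \in lpow 3 by case: vcu => ->; rewrite (mul_lpow2_lpow3 c u2).
  exists u, v => w w4 w0; split.
  - exact: filtered_basis.
  - exact: uS.
  - exact: u3.
  - exact: (ex_intro2 _ _ c cxy vcu).
  - exact: (conj w4 w0).
by case/orP: cu; [exists (mul c u) | exists (mul u c)]; auto.
Qed.

(** Membership of v in A_4 = <[w]> would contradict the freeness of the basis. *)
Lemma adapted_notin_lpow4 u v w : adapted mul x y u v w -> v \notin lpow 4.
Proof.
case=> /basis_free freeX _ _ _ [w4 w0]; rewrite (lpow4_line w4 w0) -span_seq1.
by move: freeX; rewrite !free_cons => /and5P[_ _ _ ].
Qed.

Lemma adapted_lpow3 u v w : adapted mul x y u v w -> v \in lpow 3.
Proof.
case=> _ /generator_product_lpow2 u2 _ [c _ vE] _.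
by case: vE => ->; rewrite (mul_lpow2_lpow3 c u2).
Qed.

Lemma adapted_quotients_spanned u v w :
  adapted mul x y u v w -> quotients_spanned mul u v w.
Proof.
move=> adX; have v4 := adapted_notin_lpow4 adX; have v3 := adapted_lpow3 adX.
have [_ /generator_product_lpow2 u2 u3 _ [w4 w0]] := adX.
have [d3 d4] := dim_lpow34.
split; last exact: lpow4_line.
- by apply: quotient_line_dim; rewrite ?lpow_subS ?dim_lpow2 ?d3.
- by apply: quotient_line_dim; rewrite ?lpow_subS ?d4 ?d3.
Qed.

End FiveDimensional.

(** * Defects of the pre-Lie identity in terms of structure constants *)

Section Defect.

Variables (F : fieldType) (A : vectType F) (mul : {bilinear A -> A -> A}).
Implicit Types (a b c : A) (X : seq A).
Local Notation lpow := (lpow mul).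

Definition pre_Lie_defect a b c :=
  (mul (mul a b) c - mul a (mul b c)) - (mul (mul b a) c - mul b (mul a c)).
Local Notation defect := pre_Lie_defect.

Lemma pre_Lie_defect0 : pre_Lie mul <-> forall a b c, defect a b c = 0.
Proof.
split=> eq0 a b c; last exact: subr0_eq (eq0 a b c).
by rewrite /pre_Lie_defect eq0 subrr.
Qed.

Lemma defectC a b c : defect a b c = - defect b a c.
Proof. by rewrite [RHS]opprB. Qed.

Lemma defect_diag a c : defect a a c = 0.
Proof. exact: subrr. Qed.

Lemma linear_combB (k : F) a b c d :
  (k *: a + b) - (k *: c + d) = k *: (a - c) + (b - d).
Proof. by rewrite opprD addrACA scalerBr. Qed.

Lemma defect_linear1 b c k a a' :
  defect (k *: a + a') b c = k *: defect a b c + defect a' b c.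
Proof.
by rewrite /pre_Lie_defect !(linearDl, linearDr, linearZl_LR, linearZr_LR)
  /= !linear_combB.
Qed.

Lemma defect_linear3 a b k c c' :
  defect a b (k *: c + c') = k *: defect a b c + defect a b c'.
Proof.
by rewrite /pre_Lie_defect !(linearDl, linearDr, linearZl_LR, linearZr_LR)
  /= !linear_combB.
Qed.

Lemma pre_Lie_span X : <<X>>%VS = fullv ->
  {in X & &, forall a b c, defect a b c = 0} -> pre_Lie mul.
Proof.
move=> spanX defX; apply/pre_Lie_defect0 => a b c.
have XX d : d \in <<X>>%VS by rewrite spanX memvf.
apply: (linear_span0 (f := fun a => defect a b c) _ _ (XX a)) => [k d d'|{}a Xa].
  exact: defect_linear1.
rewrite defectC; apply/eqP; rewrite oppr_eq0; apply/eqP.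
apply: (linear_span0 (f := fun b => defect b a c) _ _ (XX b)) => [k d d'|{}b Xb].
  exact: defect_linear1.
apply: (linear_span0 (f := defect b a) _ _ (XX c)) => [k d d'|{}c Xc].
  exact: defect_linear3.
exact: defX.
Qed.

(** The defect adds up the filtration degrees of its entries, so a vanishing power
    disposes of all the triples of large total degree. *)
Lemma defect_lpow i j k a b c : (0 < i)%N -> (0 < j)%N -> (0 < k)%N ->
  a \in lpow i -> b \in lpow j -> c \in lpow k ->
  defect a b c \in lpow (i + j + k).
Proof.
move=> i0 j0 k0 ai bj ck.
suff assoc l m d e : (0 < l)%N -> (0 < m)%N -> d \in lpow l -> e \in lpow m ->
    mul (mul d e) c - mul d (mul e c) \in lpow (l + m + k).
  by apply: memvB; last rewrite [(i + j)%N]addnC; apply: assoc.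
move=> l0 m0 dl em; apply: memvB; last rewrite -addnA;
  by rewrite !mul_lpow // addn_gt0 ?l0 ?m0.
Qed.

Section Constants.

Variables (x y u v w : A) (alpha beta gamma delta nu mu : A -> A -> F).
Hypothesis expand : expansions mul x y u v w alpha beta gamma delta nu mu.
Hypotheses (u2 : u \in lpow 2) (v3 : v \in lpow 3) (w4 : w \in lpow 4).
Hypothesis lpow5_eq0 : lpow 5 = 0%VS.
Local Notation gen := [:: x; y].

Lemma mul_lpow_eq0 i j a b : (0 < i)%N -> (0 < j)%N -> (5 <= i + j)%N ->
  a \in lpow i -> b \in lpow j -> mul a b = 0.
Proof.
move=> i0 j0 ij ai bj; apply/eqP; rewrite -memv0 -lpow5_eq0.
by apply: subvP (mul_lpow i0 j0 ai bj); apply: lpowS_sub.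
Qed.

Lemma defect_lpow_eq0 i j k a b c : (0 < i)%N -> (0 < j)%N -> (0 < k)%N ->
  (5 <= i + j + k)%N -> a \in lpow i -> b \in lpow j -> c \in lpow k ->
  defect a b c = 0.
Proof.
move=> i0 j0 k0 ijk ai bj ck; apply/eqP; rewrite -memv0 -lpow5_eq0.
by apply: subvP (defect_lpow i0 j0 k0 ai bj ck); apply: lpowS_sub.
Qed.

Lemma in_lpow1 a : a \in lpow 1. Proof. by rewrite lpow1 memvf. Qed.

Lemma mulw a : (mul w a = 0) * (mul a w = 0).
Proof.
by split; [apply: (@mul_lpow_eq0 4 1) | apply: (@mul_lpow_eq0 1 4)];
  rewrite ?in_lpow1.
Qed.

Lemma muluv : (mul u v = 0) * (mul v u = 0).
Proof. by split; [apply: (@mul_lpow_eq0 2 3) | apply: (@mul_lpow_eq0 3 2)]. Qed.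

Local Notation vw r s := (r *: v + s *: w).

Lemma vwB r s r' s' : vw r s - vw r' s' = vw (r - r') (s - s').
Proof. by rewrite opprD addrACA -!scalerBl. Qed.

Local Notation mulE := (linearDl, linearDr, linearZl_LR, linearZr_LR) (only parsing).

(** Multiplying an expansion by a generator kills its w-term, because A_5 = 0, and
    turns its v-term into a multiple of w. *)
Lemma mul_gen2 i j k : i \in gen -> j \in gen -> k \in gen ->
  (mul (mul i j) k
     = vw (alpha i j * delta u k) (alpha i j * nu u k + beta i j * mu v k)) *
  (mul k (mul i j)
     = vw (alpha i j * delta k u) (alpha i j * nu k u + beta i j * mu k v)).
Proof.
case: expand => ex2 ex3 _ ex4 gi gj gk.
have [ku uk] := ex3 k gk; have [vk kv] := ex4 k gk.
by rewrite (ex2 i j gi gj) !mulE /= !mulw ku uk vk kv scaler0 !addr0 !scalerDr !scalerA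
  -!addrA -!scalerDl.
Qed.

Lemma mul_gen2_u i j : i \in gen -> j \in gen ->
  (mul (mul i j) u = (alpha i j * mu u u) *: w) *
  (mul u (mul i j) = (alpha i j * mu u u) *: w).
Proof.
case: expand => ex2 _ ex3 _ gi gj.
by rewrite (ex2 i j gi gj) !mulE /= !mulw !muluv ex3 !scaler0 !addr0 scalerA.
Qed.

Lemma mul_gen_u2 i j : i \in gen -> j \in gen ->
  ((mul (mul i u) j = (delta i u * mu v j) *: w) *
   (mul j (mul i u) = (delta i u * mu j v) *: w)) *
  ((mul (mul u i) j = (delta u i * mu v j) *: w) *
   (mul j (mul u i) = (delta u i * mu j v) *: w)).
Proof.
case: expand => _ ex3 _ ex4 gi gj.
have [-> ->] := ex3 i gi; have [vj jv] := ex4 j gj.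
by rewrite !mulE /= !mulw vj jv !scaler0 !addr0 !scalerA.
Qed.

Lemma defect_gen i j k : i \in gen -> j \in gen -> k \in gen ->
  defect i j k =
  vw (alpha i j * delta u k - alpha j k * delta i u
      - (alpha j i * delta u k - alpha i k * delta j u))
     (alpha i j * nu u k + beta i j * mu v k
      - (alpha j k * nu i u + beta j k * mu i v)
      - (alpha j i * nu u k + beta j i * mu v k
         - (alpha i k * nu j u + beta i k * mu j v))).
Proof.
by move=> gi gj gk; rewrite /pre_Lie_defect !mul_gen2 // !vwB.
Qed.

Lemma defect_gen_u i j : i \in gen -> j \in gen ->
  defect i j u =
  (alpha i j * mu u u - delta j u * mu i v
   - (alpha j i * mu u u - delta i u * mu j v)) *: w.
Proof.
by move=> gi gj; rewrite /pre_Lie_defect !mul_gen2_u // !mul_gen_u2 // -!scalerBl.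
Qed.

Lemma defect_u_gen i k : i \in gen -> k \in gen ->
  defect i u k =
  (delta i u * mu v k - delta u k * mu i v
   - (delta u i * mu v k - alpha i k * mu u u)) *: w.
Proof.
by move=> gi gk; rewrite /pre_Lie_defect !mul_gen2_u // !mul_gen_u2 // -!scalerBl.
Qed.

Lemma scalar_eq0 (a b c : F) : a = b -> c = a - b -> c = 0.
Proof. by move=> -> ->; rewrite subrr. Qed.

(** The multiplier k serves for the relations that are multiples of one defect
    coefficient by some alpha i j; elsewhere k is 1. *)
Lemma scalar_eq (k a b e : F) : e = 0 -> a - b = k * e -> a = b.
Proof. by move=> -> ab; apply: subr0_eq; rewrite ab mulr0. Qed.

Lemma vw_eq0 r s : r = 0 -> s = 0 -> vw r s = 0.
Proof. by move=> -> ->; rewrite !scale0r addr0. Qed.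

(** The basis triples of degree at most 4 are those treated by [defect_gen],
    [defect_gen_u] and [defect_u_gen], up to exchanging the first two entries. *)
Lemma relations_pre_Lie :
  <<[:: x; y; u; v; w]>>%VS = fullv ->
  ~ (forall i j, i \in gen -> j \in gen -> alpha i j = 0) ->
  relations x y u v alpha beta delta nu mu -> pre_Lie mul.
Proof.
move=> spanX alpha_neq0.
case=> r1 [r2 [r3 [r4 [r5 [r6 [r7 [r8 [r9 [r10 [r11 r12]]]]]]]]]].
have gx : x \in gen by rewrite inE eqxx.
have gy : y \in gen by rewrite !inE eqxx orbT.
have gen_antisym c : defect x y c = 0 ->
    forall a b, a \in gen -> b \in gen -> defect a b c = 0.
  move=> dxy a b; rewrite !inE => /orP[]/eqP-> /orP[]/eqP->;
    by rewrite ?defect_diag // ?[defect y x _]defectC dxy ?oppr0.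
have dgen a b c : a \in gen -> b \in gen -> c \in gen -> defect a b c = 0.
  move=> ga gb gc; apply: gen_antisym ga gb; move: gc.
  rewrite !inE => /orP[]/eqP->.
    rewrite defect_gen //; apply: vw_eq0.
      by apply: scalar_eq0 r1 _; ring.
    by apply: scalar_eq0 r3 _; ring.
  rewrite defectC defect_gen // vw_eq0 ?oppr0 //.
    by apply: scalar_eq0 r2 _; ring.
  by apply: scalar_eq0 r4 _; ring.
have dgenu a b : a \in gen -> b \in gen -> defect a b u = 0.
  apply: gen_antisym; rewrite defect_gen_u //; set E := (X in X *: w).
  (* E is killed by every alpha i j, one of which is non-zero. *)
  have aE i j : i \in gen -> j \in gen -> alpha i j * E = 0.
    rewrite !inE /E => /orP[]/eqP-> /orP[]/eqP->.
    - by apply: scalar_eq0 r7 _; ring.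
    - by apply: scalar_eq0 r5 _; ring.
    - by apply: scalar_eq0 r6 _; ring.
    - by apply: scalar_eq0 r8 _; ring.
  have [-> | E0] := eqVneq E 0; first exact: scale0r.
  case: alpha_neq0 => i j gi gj; apply/eqP.
  by move/eqP: (aE i j gi gj); rewrite mulf_eq0 (negbTE E0) orbF.
have dugen a c : a \in gen -> c \in gen -> defect a u c = 0.
  move=> ga gc; rewrite defect_u_gen //; set E := (X in X *: w).
  suff -> : E = 0 by rewrite scale0r.
  move: ga gc; rewrite /E !inE => /orP[]/eqP-> /orP[]/eqP->.
  - by apply: scalar_eq0 r10 _; ring.
  - by apply: scalar_eq0 r9 _; ring.
  - by apply: scalar_eq0 r12 _; ring.
  - by apply: scalar_eq0 r11 _; ring.
have split_gen a : a \in [:: x; y; u; v; w] ->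
    [\/ a \in gen, a = u | a \in lpow 3].
  rewrite -[_ :: _ in X in X -> _]/(gen ++ [:: u; v; w]) mem_cat.
  case/orP=> [|]; first by constructor 1.
  rewrite !inE => /or3P[]/eqP->; [by constructor 2 | by constructor 3 |].
  by constructor 3; apply: subvP (lpow_subS mul (i := 3) isT) _ w4.
have deep1 a b c : a \in lpow 3 -> defect a b c = 0.
  by move=> a3; apply: (@defect_lpow_eq0 3 1 1); rewrite ?in_lpow1.
have deep2 a b c : b \in lpow 3 -> defect a b c = 0.
  by move=> b3; rewrite defectC deep1 ?oppr0.
have deep3 a b c : c \in lpow 3 -> defect a b c = 0.
  by move=> c3; apply: (@defect_lpow_eq0 1 1 3); rewrite ?in_lpow1.
apply: pre_Lie_span spanX _ => a b c /split_gen Xa /split_gen Xb /split_gen Xc.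
case: Xa => [ga|->|a3]; last exact: deep1.
  case: Xb => [gb|->|b3]; last exact: deep2.
    case: Xc => [gc|->|c3]; [exact: dgen | exact: dgenu | exact: deep3].
  case: Xc => [gc|->|c3]; [exact: dugen | | exact: deep3].
  by apply: (@defect_lpow_eq0 1 2 2); rewrite ?in_lpow1.
case: Xb => [gb|->|b3]; [|exact: defect_diag | exact: deep2].
case: Xc => [gc|->|c3]; last exact: deep3.
  by rewrite defectC dugen ?oppr0.
by apply: (@defect_lpow_eq0 2 1 2); rewrite ?in_lpow1.
Qed.

(** Conversely the vanishing of the defects yields the relations, by uniqueness of
    the coordinates along v and w. *)
Lemma pre_Lie_relations :
  free [:: v; w] -> pre_Lie mul -> relations x y u v alpha beta delta nu mu.
Proof.
move=> free_vw /pre_Lie_defect0 def0.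
have gx : x \in gen by rewrite inE eqxx.
have gy : y \in gen by rewrite !inE eqxx orbT.
have w0 : w != 0 by move: free_vw; rewrite free_cons seq1_free => /andP[].
have w_eq0 s : s *: w = 0 -> s = 0.
  by move/eqP; rewrite scaler_eq0 (negbTE w0) orbF => /eqP.
have vw_inj r s : vw r s = 0 -> r = 0 /\ s = 0.
  move=> rs0; suff r0 : r = 0 by split=> //; apply: w_eq0; rewrite -rs0 r0 scale0r add0r.
  apply/eqP; apply: contraLR free_vw => r0; rewrite free_cons negb_and negbK.
  apply/orP; left; rewrite span_seq1; apply/vlineP; exists (- r^-1 * s).
  apply: (scalerI r0); rewrite scalerA mulrA mulrN divff // mulN1r scaleNr.
  by apply/eqP; rewrite -addr_eq0 rs0.
have [] := vw_inj _ _ (etrans (esym (defect_gen gx gy gx)) (def0 x y x)).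
move=> e1 e3.
have [] := vw_inj _ _ (etrans (esym (defect_gen gy gx gy)) (def0 y x y)).
move=> e2 e4.
have e5 := w_eq0 _ (etrans (esym (defect_gen_u gx gy)) (def0 x y u)).
have e9 i k gi gk := w_eq0 _ (etrans (esym (@defect_u_gen i k gi gk)) (def0 i u k)).
repeat split.
- by apply: (scalar_eq (k := 1) e1); ring.
- by apply: (scalar_eq (k := 1) e2); ring.
- by apply: (scalar_eq (k := 1) e3); ring.
- by apply: (scalar_eq (k := 1) e4); ring.
- by apply: (scalar_eq (k := alpha x y) e5); ring.
- by apply: (scalar_eq (k := alpha y x) e5); ring.
- by apply: (scalar_eq (k := alpha x x) e5); ring.
- by apply: (scalar_eq (k := alpha y y) e5); ring.
- by apply: (scalar_eq (k := 1) (e9 x y gx gy)); ring.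
- by apply: (scalar_eq (k := 1) (e9 x x gx gx)); ring.
- by apply: (scalar_eq (k := 1) (e9 y y gy gy)); ring.
- by apply: (scalar_eq (k := 1) (e9 y x gy gx)); ring.
Qed.

End Constants.

End Defect.

(** * The structure relations *)

Section Structure.

Variables (F : fieldType) (A : vectType F) (mul : {bilinear A -> A -> A}).
Implicit Types (x y u v w : A).
Local Notation lpow := (lpow mul).

(** All six families of coefficients are coordinates of products along u, v or w.
    The coordinate along u vanishes on A_3 and the one along v on A_4, which gives
    the expansions their shape; the alpha of the product defining u and the delta
    of the one defining v are 1. *)
Lemma adapted_structure_relations x y u v w :
  \dim {:A} = 5%N -> pre_Lie mul -> minimally_generates mul [:: x; y] ->
  lpow 4 <> 0%VS -> lpow 5 = 0%VS ->
  adapted mul x y u v w -> structure_relations mul x y u v w.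
Proof.
move=> dimA preLie min_gen nil4 nil5 adX.
have [basX uS u3 [c cxy vcu] [w4 w0]] := adX.
have v4 := adapted_notin_lpow4 dimA preLie min_gen nil4 nil5 adX.
have v3 := adapted_lpow3 adX; have u2 := generator_product_lpow2 uS.
have lpow4E := lpow4_line dimA preLie min_gen nil4 nil5 w4 w0.
have lpow3E : lpow 3 = <<[:: v; w]>>%VS.
  rewrite (lpow3_modulo dimA preLie min_gen nil4 nil5 v3 v4) lpow4E.
  by rewrite [in RHS]span_cons !span_seq1.
have lpow2E : lpow 2 = <<[:: u; v; w]>>%VS.
  rewrite (lpow2_modulo dimA preLie min_gen nil4 nil5 u2 u3) lpow3E.
  by rewrite [in RHS]span_cons !span_seq1.
pose Y := [tuple u; v; w].
have freeY : free Y by have := basis_free basX; rewrite !free_cons => /and3P[].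
pose cu := coord Y 0; pose cv := coord Y 1; pose cw := coord Y 2.
have cE a : a \in lpow 2 -> a = cu a *: u + cv a *: v + cw a *: w.
  rewrite lpow2E => /(coord_span (X := Y)) aE.
  rewrite [LHS]aE !big_ord_recl big_ord0 addr0 addrA.
  by congr (_ + coord Y _ a *: _ + coord Y _ a *: _); apply: val_inj.
have cuD a b : cu (a + b) = cu a + cu b by exact: linearD.
have cuZ k a : cu (k *: a) = k * cu a by exact: linearZ.
have cvZ k a : cv (k *: a) = k * cv a by exact: linearZ.
have cu_u : cu u = 1 by rewrite /cu (coord_free (X := Y) 0 0 freeY).
have cu_v : cu v = 0 by rewrite /cu (coord_free (X := Y) 1 0 freeY).
have cu_w : cu w = 0 by rewrite /cu (coord_free (X := Y) 2 0 freeY).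
have cv_v : cv v = 1 by rewrite /cv (coord_free (X := Y) 1 1 freeY).
have cv_w : cv w = 0 by rewrite /cv (coord_free (X := Y) 2 1 freeY).
have cE4 a : a \in lpow 4 -> a = cw a *: w.
  move=> a4; have a2 : a \in lpow 2 by apply: subvP a a4; apply: lpowS_sub.
  rewrite {1}(cE _ a2); move: a4; rewrite lpow4E => /vlineP[k ->].
  by rewrite cuZ cvZ cu_w cv_w !mulr0 !scale0r !add0r.
have cE3 a : a \in lpow 3 -> a = cv a *: v + cw a *: w.
  move=> a3; have a2 : a \in lpow 2 by apply: subvP a a3; apply: lpowS_sub.
  rewrite {1}(cE _ a2); suff -> : cu a = 0 by rewrite scale0r add0r.
  move: a3; rewrite lpow3E span_cons span_seq1.
  case/memv_addP=> _ /vlineP[k ->] [_ /vlineP[l ->] ->].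
  by rewrite cuD !cuZ cu_v cu_w !mulr0 addr0.
have in1 a : a \in lpow 1 by rewrite lpow1 memvf.
exists (fun a b => cu (mul a b)), (fun a b => cv (mul a b)),
  (fun a b => cw (mul a b)), (fun a b => cv (mul a b)),
  (fun a b => cw (mul a b)), (fun a b => cw (mul a b)).
have expand : expansions mul x y u v w
    (fun a b => cu (mul a b)) (fun a b => cv (mul a b))
    (fun a b => cw (mul a b)) (fun a b => cv (mul a b))
    (fun a b => cw (mul a b)) (fun a b => cw (mul a b)).
  split=> [i j _ _ | k _ | | n _].
  - by apply: cE; apply: (mul_lpow (i := 1) (j := 1)).
  - by split; apply: cE3; rewrite (mul_lpow2_lpow3 k u2).
  - by apply: cE4; apply: (mul_lpow (i := 2) (j := 2)).
  - by split; apply: cE4; [apply: (mul_lpow (i := 3) (j := 1))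
      | apply: (mul_lpow (i := 1) (j := 3))].
split; first exact: expand.
- have gx : x \in [:: x; y] by rewrite inE eqxx.
  have gy : y \in [:: x; y] by rewrite !inE eqxx orbT.
  move=> alpha0; have: cu u = 0.
    by move: uS; rewrite !inE => /or4P[]/eqP->; apply: alpha0.
  by apply/eqP; rewrite cu_u oner_eq0.
- move=> /(_ c cxy)[cvl cvr]; have: cv v = 0 by case: vcu => {1}->.
  by apply/eqP; rewrite cv_v oner_eq0.
- apply: pre_Lie_relations expand u2 v3 w4 nil5 _ preLie.
  by have: free [:: u; v; w] := freeY; rewrite free_cons => /andP[].
Qed.

Lemma structure_relations_pre_Lie x y u v w :
  lpow 5 = 0%VS -> adapted mul x y u v w -> quotients_spanned mul u v w ->
  structure_relations mul x y u v w -> pre_Lie mul.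
Proof.
move=> nil5 [basX _ _ _ [w4 _]] [[_ u2 _] [_ v3 _] _].
case=> alpha [beta [gamma [delta [nu [mu [expand alpha0 _ rel]]]]]].
exact: relations_pre_Lie expand u2 v3 w4 nil5 (span_basis basX) alpha0 rel.
Qed.

End Structure.

Theorem theorem5p3p1 (p : nat) (p_prime : prime p) :
  (forall (A : vectType 'F_p) (mul : {bilinear A -> A -> A}) (x y : A),
     \dim {:A} = 5%N ->
     pre_Lie mul ->
     minimally_generates mul [:: x; y] ->
     lpow mul 4 <> 0%VS ->
     lpow mul 5 = 0%VS ->
     (exists u v : A, forall w : A,
        w \in lpow mul 4 -> w != 0 -> adapted mul x y u v w) /\
     (forall u v w : A, adapted mul x y u v w ->
        quotients_spanned mul u v w /\ structure_relations mul x y u v w)) /\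
  (forall (A : vectType 'F_p) (mul : {bilinear A -> A -> A}) (x y : A),
     \dim {:A} = 5%N ->
     generates mul [:: x; y] ->
     lpow mul 4 <> 0%VS ->
     lpow mul 5 = 0%VS ->
     (exists u v w : A,
        [/\ adapted mul x y u v w,
            quotients_spanned mul u v w
          & structure_relations mul x y u v w]) ->
     pre_Lie mul).
Proof.
split=> [A mul x y dimA preLie min_gen nil4 nil5|A mul x y _ _ _ nil5 [u [v [w []]]]].
  split=> [|u v w adX]; first exact: exists_adapted.
  split; first exact: adapted_quotients_spanned adX.
  exact: adapted_structure_relations.
exact: structure_relations_pre_Lie.
Qed.
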